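(* Let $G$ be a countably infinite amenable group, and let $(X,T)$ be a $G$-subshift. Let $\mathcal{H}_{sub}(X)$ denote the set of numbers $r \in \mathbb{R}$ such that there exist a $G$-subshift $(Z,R)$ with $h(Z,R) = r$ and a factor map from $(X,T)$ onto $(Z,R)$. Then $\mathcal{H}_{sub}(X)$ is dense in the interval $[0,h(X,T)]$.
   Context: For a finite alphabet $\mathcal{A}$, the full shift $\mathcal{A}^G$ carries the product topology (with $\mathcal{A}$ discrete) and the shift action $\sigma=(\sigma^g)_{g\in G}$, $(\sigma^g(x))(h) = x(hg)$. A $G$-subshift is a nonempty closed $\sigma$-invariant subset $X\subset\mathcal{A}^G$ for some finite alphabet $\mathcal{A}$ (the alphabet may vary from subshift to subshift), together with the restricted action $T=\sigma|_X$. A factor map $(X,T)\to(Z,R)$ is a continuous surjection commuting with the actions. A Følner sequence is a sequence $\{F_n\}$ of nonempty finite subsets of $G$ with $|KF_n\,\triangle\,F_n|/|F_n|\to 0$ for each finite $K\subset G$. $h(X,T)$ is topological entropy: $h(X,T)=\sup_{\mathcal U}\lim_n \frac{1}{|F_n|}\log N\bigl(\bigvee_{g\in F_n}T^{g^{-1}}\mathcal{U}\bigr)$, where the supremum is over finite open covers $\mathcal{U}$ of $X$, $N(\cdot)$ is the minimal cardinality of a subcover, and $\{F_n\}$ is a Følner sequence (the limit exists and does not depend on the choice of sequence). For a subshift this equals $\lim_n \frac{1}{|F_n|}\log |\{x(F_n): x\in X\}|$, where $x(F_n)$ is the restriction of $x$ to $F_n$. *)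

(* Defs.v *)
From HB Require Import structures.
From mathcomp Require Import all_boot all_order all_algebra finmap.
From mathcomp Require Import all_classical all_reals all_analysis.

Set Implicit Arguments.
Unset Strict Implicit.
Unset Printing Implicit Defensive.

Import Order.TTheory GRing.Theory Num.Theory.
Import numFieldNormedType.Exports.

Local Open Scope classical_set_scope.
Local Open Scope ring_scope.

Definition fset_mulg (G : groupType) (K E : {fset G}) : {fset G} :=
  [fset (k * g)%g | k in K, g in E]%fset.

Definition fset_symdiff (G : groupType) (A B : {fset G}) : {fset G} :=
  ((A `\` B) `|` (B `\` A))%fset.

(* [K] has to be nonempty: for [K = fset0] the quotient is constantly 1. *)
Definition folner_sequence (R : realType) (G : groupType)
    (F : nat -> {fset G}) : Prop :=
  (forall n, F n != fset0) /\
  (forall K : {fset G}, K != fset0 ->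
    (fun n => #|` fset_symdiff (fset_mulg K (F n)) (F n)|%:R / #|` F n|%:R : R)
      @ \oo --> (0 : R)).

Definition amenable (R : realType) (G : groupType) : Prop :=
  exists F : nat -> {fset G}, folner_sequence R F.

Definition finite_open_cover (X : topologicalType) (U : set (set X)) : Prop :=
  [/\ finite_set U, U `<=` open & \bigcup_(A in U) A = [set: X]].

Definition subcover_cards (X : Type) (U : set (set X)) : set nat :=
  [set n | exists V : set (set X),
    [/\ V `<=` U, \bigcup_(A in V) A = [set: X] & (V #= `I_n)%card]].

(* The least element of [subcover_cards U]; it exists when [U] is a finite
   cover, and the default value 0 is not used in that case. *)
Definition min_subcover (X : Type) (U : set (set X)) : nat :=
  xget 0%N (subcover_cards U `&` lbound (subcover_cards U)).

(* The join over [g] in [E] of the families [T^(g^-1) U]: all intersections of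
   sets [T^(g^-1) (V g)] with one choice [V g] in [U] for each [g] in [E]. *)
Definition dyn_join (G : groupType) (X : Type) (T : G -> X -> X)
    (E : {fset G}) (U : set (set X)) : set (set X) :=
  [set \bigcap_(g in [set` E]) (T g^-1%g @` V g)
    | V in [set V : G -> set X | forall g, g \in E -> U (V g)]].

Definition cover_entropy (R : realType) (G : groupType)
    (F : nat -> {fset G}) (X : Type) (T : G -> X -> X)
    (U : set (set X)) : R :=
  lim ((fun n => (#|` F n|%:R)^-1 *
                 ln ((min_subcover (dyn_join T (F n) U))%:R : R)) @ \oo).

Definition topological_entropy (R : realType) (G : groupType)
    (F : nat -> {fset G}) (X : topologicalType) (T : G -> X -> X) : \bar R :=
  ereal_sup [set (cover_entropy R F T U)%:E
              | U in [set U : set (set X) | finite_open_cover U]].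

Definition factor_map (G : groupType) (X Z : topologicalType)
    (T : G -> X -> X) (S : G -> Z -> Z) (phi : X -> Z) : Prop :=
  [/\ continuous phi, range phi = [set: Z] &
      forall g x, phi (T g x) = S g (phi x)].

Definition full_shift (G : groupType) (A : finType) : topologicalType :=
  {ptws G -> discrete_topology A}.

Definition shift (G : groupType) (A : finType) (g : G)
    (x : full_shift G A) : full_shift G A :=
  fun h => x (h * g)%g.

Record subshift (G : groupType) := Subshift {
  alphabet : finType;
  carrier : set (full_shift G alphabet);
  carrier_neq0 : carrier !=set0;
  carrier_closed : closed carrier;
  carrier_shift : forall g x, carrier x -> carrier (shift g x) }.

Arguments carrier {G} s.

(* The points of a subshift, with the subspace topology. *)
Definition points (G : groupType) (X : subshift G) : topologicalType :=
  set_type (carrier X).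

Definition shift_action (G : groupType) (X : subshift G) (g : G)
    (x : points X) : points X :=
  SigSub (mem_set (@carrier_shift G X g _ (set_valP x))).

Definition subshift_entropy (R : realType) (G : groupType)
    (F : nat -> {fset G}) (X : subshift G) : \bar R :=
  topological_entropy R F (@shift_action G X).

Definition subshift_factor_entropies (R : realType) (G : groupType)
    (F : nat -> {fset G}) (X : subshift G) : set R :=
  [set r | exists Z : subshift G, subshift_entropy R F Z = r%:E /\
    exists phi : points X -> points Z,
      factor_map (@shift_action G X) (@shift_action G Z) phi].

Arguments subshift_factor_entropies R {G} F X _.

Definition dense_in (T : topologicalType) (S I : set T) : Prop :=
  S `<=` I /\ I `<=` closure S.

(* Main.v *)
(* Write c(E) for the number of patterns of a subshift on a finite set E. Shearer's
   inequality gives c(W)^|K| <= c(K)^|K^-1 W|, hence the infimum rule: the entropy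
   along any Folner sequence is the infimum of ln c(K) / |K| over all nonempty
   finite K. So a single finite set suffices to bound an entropy from above.

   Fix N and finite sets D, K whose product KD is direct. A pattern p on KD is
   "good" when the rows k |-> p(kd), d in D, take more than N values. Choosing
   N + 1 distinct rows d_0, ..., d_N, p occurs at most once among the sites
   d_i^-1, so the factor recording the occurrences of p has entropy at most
   ln(N + 2) / (N + 1). There are at most (N + 1)^|D| |A|^(|K| (N + 1)) bad
   patterns, a number whose logarithm is small compared with |K| |D|; applying
   Shearer's inequality to the fibres, the factor revealing all good patterns has
   almost full entropy. Revealing the good patterns one at a time therefore gives a
   chain of subshift factors whose entropies go from 0 to nearly h(X) by small
   steps. *)
Require Import Defs.
From mathcomp Require Import all_boot all_order all_algebra finmap.
From mathcomp Require Import all_classical all_reals all_analysis.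
From mathcomp Require Import zify ring lra.
Import Order.TTheory GRing.Theory Num.Theory.
Import numFieldNormedType.Exports.
Local Open Scope classical_set_scope.
Local Open Scope ring_scope.
Set Implicit Arguments.
Unset Strict Implicit.
Unset Printing Implicit Defensive.

(** * Counting patterns *)

(** The set [S] is a parameter so that the same count can be taken on a fibre. *)
Definition image_card (T : Type) (V : finType) (S : set T) (o : T -> V) : nat :=
  #|[pred v | `[< (o @` S) v >]]|.

Lemma image_card_gt0 (T : Type) (V : finType) (S : set T) (o : T -> V) :
  S !=set0 -> (0 < image_card S o)%N.
Proof. by case=> x Sx; apply/card_gt0P; exists (o x); apply/asboolP; exists x. Qed.

Lemma image_card_factor (T : Type) (V W : finType) (S S' : set T)
    (o : T -> V) (o' : T -> W) :
  S `<=` S' -> (forall x y, S x -> S y -> o' x = o' y -> o x = o y) ->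
  (image_card S o <= image_card S' o')%N.
Proof.
move=> SS' det; rewrite /image_card.
(* [w0] is a default value for [h]; if [W] is empty then so is [T], and both counts vanish. *)
have [[w0 _]|W0] := pselect (exists w : W, True); last first.
  rewrite [X in (X <= _)%N]fintype.eq_card0 // => v; apply/negbTE/negP.
  by move=> /asboolW[x _ _]; apply: W0; exists (o' x).
pose h v := if pselect (exists2 x, S x & o x = v) is left e
  then o' (projT1 (cid2 e)) else w0.
have hP v : (o @` S) v -> exists x, [/\ S x, o x = v & o' x = h v].
  move=> e; rewrite /h; case: pselect => [e'|/(_ e)//].
  by case: (cid2 e') => x Sx ox /=; exists x.
have hinj : {in [pred v | `[< (o @` S) v >]] &, injective h}.
  move=> v w; rewrite !inE => vS wS exy.
  have [x [Sx ox xh]] := hP _ vS; have [y [Sy oy yh]] := hP _ wS.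
  rewrite -ox -oy.
  by apply: det => //; rewrite xh yh.
rewrite -(card_in_image hinj).
apply/subset_leq_card/fintype.subsetP => w /fintype.imageP[v].
rewrite inE => vS ->.
have [x [Sx _ xh]] := hP _ vS; rewrite inE.
by exists x => //; exact: SS'.
Qed.

Lemma image_card_prod (T : Type) (V W1 W2 : finType) (S : set T)
    (o : T -> V) (o1 : T -> W1) (o2 : T -> W2) :
  (forall x y, S x -> S y -> o1 x = o1 y -> o2 x = o2 y -> o x = o y) ->
  (image_card S o <= image_card S o1 * image_card S o2)%N.
Proof.
move=> det; apply: (@leq_trans (image_card S (fun x => (o1 x, o2 x)))).
  by apply: image_card_factor => // x y Sx Sy [] /det; apply.
rewrite /image_card -cardX; apply/subset_leq_card/fintype.subsetP => -[a b].
rewrite !inE /= => -[x Sx [<- <-]].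
by apply/andP; split; apply/asboolP; exists x.
Qed.

Lemma image_card_le_sum (T : Type) (V W : finType) (S : set T)
    (o : T -> V) (o' : T -> W) :
  (image_card S o <=
   \sum_(w | `[< (o' @` S) w >]) image_card (S `&` [set x | o' x = w]) o)%N.
Proof.
rewrite /image_card -sum1_card.
rewrite (eq_bigr (fun w => \sum_(v in [pred v |
  `[< (o @` (S `&` [set x | o' x = w])) v >]]) 1)%N); last first.
  by move=> w _; rewrite sum1_card.
rewrite (exchange_big_dep
  (fun v => v \in [pred v | `[< (o @` S) v >]])) /=; last first.
  move=> w v _; rewrite !inE => -[x [Sx _] <-].
  by exists x.
apply: leq_sum => v; rewrite inE => -[x Sx <-].
rewrite (bigD1 (o' x)) //=; apply/andP; split; first by apply/asboolP; exists x.
by rewrite inE; exists x.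
Qed.

(** When [o] determines [o'], each value of [o] occurs in a single fibre of [o'], so nothing is
    counted twice. *)
Lemma sum_image_card_le (T : Type) (V W : finType) (S : set T)
    (o : T -> V) (o' : T -> W) :
  (forall x y, S x -> S y -> o x = o y -> o' x = o' y) ->
  (\sum_w image_card (S `&` [set x | o' x = w]) o <= image_card S o)%N.
Proof.
move=> det; rewrite /image_card -sum1_card.
rewrite (eq_bigr (fun w => \sum_(v in [pred v |
  `[< (o @` (S `&` [set x | o' x = w])) v >]]) 1)%N); last first.
  by move=> w _; rewrite sum1_card.
rewrite (exchange_big_dep
  (fun v => v \in [pred v | `[< (o @` S) v >]])) /=; last first.
  move=> w v _; rewrite !inE => -[x [Sx _] <-].
  by exists x.
apply: leq_sum => v; rewrite inE => -[x Sx <-].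
rewrite sum1_card -[leqRHS](card1 (o' x)); apply/eq_leq.
apply: fintype.eq_card => w; apply/idP/idP; rewrite !inE.
  by move=> -[y [Sy <-] oyx]; apply/eqP; exact: det.
by move=> /eqP ->; exists x.
Qed.

(** Hoelder's inequality for [k] factors: normalise each [u i] to have sum 1 and apply the
    arithmetic-geometric mean inequality at every [v]. *)
Lemma le_sum_expn_prod (R : realType) (k : nat) (V : finType)
    (I : finType) (J : {pred I}) (Q : R) (c : V -> R)
    (u : I -> V -> R) :
  #|J| = k -> (0 < k)%N -> 0 <= Q ->
  (forall v, 0 <= c v) -> (forall i v, 0 <= u i v) ->
  (forall v, c v ^+ k <= Q * \prod_(i in J) u i v) ->
  (\sum_v c v) ^+ k <= Q * \prod_(i in J) \sum_v u i v.
Proof.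
move=> Jk k0 Q0 c0 u0 cu; pose U i := \sum_v u i v.
have U0 i : 0 <= U i by apply: sumr_ge0.
have [[i [iJ Ui0]]|noz] := pselect (exists i, i \in J /\ U i = 0).
  have ui0 v : u i v = 0.
    apply/eqP; have := Ui0 => /eqP; rewrite psumr_eq0// => /allP/(_ v).
    by rewrite mem_index_enum => /(_ isT).
  have -> : \sum_v c v = 0.
    rewrite big1// => v _; apply/eqP.
    have := cu v; rewrite (bigD1 i)//= ui0 mul0r mulr0 => le0.
    have : c v ^+ k == 0 by rewrite eq_le le0 exprn_ge0.
    by rewrite expf_eq0 => /andP[].
  rewrite expr0n gtn_eqF//=; apply: mulr_ge0 => //.
  by apply: prodr_ge0 => j _; exact: U0.
have Up i : i \in J -> 0 < U i.
  move=> iJ; rewrite lt_neqAle U0 andbT eq_sym; apply/eqP => Ui.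
  by apply: noz; exists i.
pose P := Q * \prod_(i in J) U i.
have P0 : 0 <= P by apply: mulr_ge0 => //; apply: prodr_ge0.
have [rho rho0 rhok] : exists2 rho : R, 0 <= rho & rho ^+ k = P.
  move: P0; rewrite le_eqVlt => /predU1P[<-|P0].
    by exists 0 => //; rewrite expr0n gtn_eqF.
  exists (expR (ln P / k%:R)); first exact: expR_ge0.
  by rewrite -expRM_natl mulrC divfK ?pnatr_eq0 -?lt0n// lnK.
rewrite -/P -[P]rhok; apply: lerXn2r; rewrite ?nnegrE ?sumr_ge0//.
(* Here [rho] is the [k]-th root of [P]. The averages on the right add up to 1 over [v], so summing
   leaves only [rho]. *)
have step v : c v <= rho * ((\sum_(i in J) u i v / U i) / k%:R).
  rewrite -(@ler_pXn2r _ k)// ?nnegrE//; last first.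
    by rewrite mulr_ge0// divr_ge0// sumr_ge0// => i _; rewrite divr_ge0.
  rewrite exprMn rhok; apply: le_trans (cu v) _.
  have -> : Q * \prod_(i in J) u i v = P * \prod_(i in J) (u i v / U i).
    rewrite /P -mulrA -big_split; congr (_ * _); apply: eq_bigr => i iJ /=.
    by rewrite mulrCA mulfV ?mulr1// gt_eqF// Up.
  rewrite ler_wpM2l// -Jk.
  have /= := @leif_AGM R I J (fun i => u i v / U i).
  by move=> -[]// i _; rewrite divr_ge0.
apply: (@le_trans _ _ (\sum_v rho * ((\sum_(i in J) u i v / U i) / k%:R))).
  exact: ler_sum.
rewrite -mulr_sumr -mulr_suml exchange_big/= ler_piMr//.
rewrite (eq_bigr (fun=> 1)); last first.
  by move=> i iJ; rewrite -mulr_suml mulfV// gt_eqF// Up.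
by rewrite sumr_const Jk mulfV// pnatr_eq0 -lt0n.
Qed.

(** * Patterns of a label on finite sets, and Shearer's inequality *)

Definition pattern (G : choiceType) (T : Type) (B : finType) (l : T -> G -> B)
  (E : {fset G}) (x : T) : {ffun E -> B} := [ffun g => l x (val g)].

Lemma patternP (G : choiceType) (T : Type) (B : finType) (l : T -> G -> B)
    (E : {fset G}) (x y : T) :
  pattern l E x = pattern l E y <-> {in E, l x =1 l y}.
Proof.
split=> [exy g gE|exy]; last by apply/ffunP => g; rewrite !ffunE exy// fsvalP.
by have /ffunP/(_ [` gE]%fset) := exy; rewrite !ffunE.
Qed.

(* Remove a point [g] of [W]: the fibres of [x |-> l x g] satisfy the inequality
   on the rest of [W], and Hoelder's inequality over [k] of the sets [E i] that
   contain [g] sums them up. *)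
Lemma shearer (R : realType) (G : choiceType) (T : Type) (B : finType)
    (l : T -> G -> B) (I : finType) (E : I -> {fset G}) (k : nat)
    (W : {fset G}) (S : set T) :
  (0 < k)%N ->
  {in W, forall g, k <= #|[pred i | g \in E i]|}%N ->
  (image_card S (pattern l W))%:R ^+ k <=
    \prod_i (image_card S (pattern l (E i)))%:R :> R.
Proof.
move=> k0.
elim/finSet_rect: W S => W IH S covW.
have [W0|[g gW]] := fset_0Vmem W.
  have [[x Sx]|S0] := pselect (S !=set0); last first.
    suff -> : image_card S (pattern l W) = 0%N.
      by rewrite expr0n gtn_eqF//=; apply: prodr_ge0 => i _; exact: ler0n.
    apply: fintype.eq_card0 => v; apply/negbTE/negP => /asboolW[x Sx _].
    by apply: S0; exists x.
  apply: (@le_trans _ _ 1).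
    rewrite exprn_ile1// lern1.
    apply: (@leq_trans (image_card S (fun=> tt))).
      by apply: image_card_factor => // a b _ _ _; apply/patternP => g; rewrite W0.
    by rewrite /image_card (leq_trans (max_card _))// card_unit.
  rewrite -natr_prod ler1n prodn_gt0// => i.
  by apply: image_card_gt0; exists x.
have [s [us ss sE]] := card_geqP (covW _ gW).
have sk : #|s| = k by rewrite (card_uniqP us).
pose Sa a := S `&` [set x | l x g = a].
apply: (@le_trans _ _
    ((\sum_a (image_card (Sa a) (pattern l (W `\ g)%fset))%:R) ^+ k)).
  rewrite lerXn2r ?nnegrE// -?natr_sum// ler_nat.
  apply: leq_trans (image_card_le_sum S (pattern l W) (fun x => l x g)) _.
  rewrite big_mkcond/=; apply: leq_sum => a _; case: ifP => // _.
  apply: image_card_factor => // x y [Sx xa] [Sy ya] /patternP exy.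
  apply/patternP => h hW; have [->|hg] := eqVneq h g; first by rewrite xa ya.
  by apply: exy; rewrite !inE hg.
rewrite (bigID (mem s))/= mulrC.
pose u i a : R := (image_card (Sa a) (pattern l (E i)))%:R.
(* For the indices outside [s], the count on a fibre is replaced by the count on all of [S], which
   does not depend on [a]. *)
pose Q : R := \prod_(i | i \notin s) (image_card S (pattern l (E i)))%:R.
apply: (@le_trans _ _ (Q * \prod_(i in s) \sum_a u i a)).
  apply: le_sum_expn_prod sk k0 _ _ _ _ => [||i a|a]; rewrite ?prodr_ge0//.
  apply: le_trans (IH (W `\ g)%fset _ (Sa a) _) _.
  - by rewrite fproperD1.
  - by move=> h; rewrite !inE => /andP[_ /covW].
  rewrite (bigID (mem s))/= mulrC ler_wpM2r ?prodr_ge0//.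
  apply: ler_prod => i _; rewrite ler0n ler_nat/=.
  by apply: image_card_factor => // x [].
rewrite ler_wpM2l ?prodr_ge0//; apply: ler_prod => i iS.
rewrite sumr_ge0//= /u -natr_sum ler_nat.
apply: sum_image_card_le => x y _ _ /patternP; apply.
by have := sE i iS.
Qed.

(** * Entropy of equivariant labels along a Folner sequence *)

Definition fset_invg (G : groupType) (K : {fset G}) : {fset G} :=
  [fset (k^-1)%g | k in K]%fset.

Lemma fset_mulgP (G : groupType) (K E : {fset G}) (g : G) :
  reflect (exists k e, [/\ k \in K, e \in E & g = (k * e)%g])
    (g \in fset_mulg K E).
Proof.
apply: (iffP (imfset2P _ _ _ _ _)) => [[k /= kK [e /= eE ->]]|[k [e [kK eE ->]]]].
  by exists k, e.
by exists k => //; exists e.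
Qed.

Lemma mem_fset_mulg (G : groupType) (K E : {fset G}) (k e : G) :
  k \in K -> e \in E -> (k * e)%g \in fset_mulg K E.
Proof. by move=> kK eE; apply/fset_mulgP; exists k, e. Qed.

Lemma mem_fset_invg (G : groupType) (K : {fset G}) (k : G) :
  k \in K -> (k^-1)%g \in fset_invg K.
Proof. by move=> kK; apply/imfsetP; exists k. Qed.

Lemma fset_mulgA (G : groupType) (A B C : {fset G}) :
  fset_mulg A (fset_mulg B C) = fset_mulg (fset_mulg A B) C.
Proof.
apply/fsetP => g; apply/fset_mulgP/fset_mulgP.
  move=> [a [h [aA /fset_mulgP[b [c [bB cC ->]]] ->]]].
  by exists (a * b)%g, c; rewrite mem_fset_mulg// mulgA.
move=> [h [c [/fset_mulgP[a [b [aA bB ->]]] cC ->]]].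
by exists a, (b * c)%g; rewrite mem_fset_mulg// mulgA.
Qed.

Lemma fset_mulg_neq0 (G : groupType) (A B : {fset G}) :
  A != fset0 -> B != fset0 -> fset_mulg A B != fset0.
Proof.
move=> /fset0Pn[a aA] /fset0Pn[b bB]; apply/fset0Pn.
by exists (a * b)%g; exact: mem_fset_mulg.
Qed.

Lemma fset_invg_neq0 (G : groupType) (A : {fset G}) :
  A != fset0 -> fset_invg A != fset0.
Proof.
move=> /fset0Pn[a aA]; apply/fset0Pn.
by exists (a^-1)%g; exact: mem_fset_invg.
Qed.

Lemma leq_card_fset_mulg (G : groupType) (A B : {fset G}) :
  A != fset0 -> (#|` B| <= #|` fset_mulg A B|)%N.
Proof.
move=> /fset0Pn[a aA].
have <- : #|` [fset (a * b)%g | b in B]%fset| = #|` B|.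
  by rewrite card_imfset//; exact: mulgI.
apply: fsubset_leq_card; apply/fsubsetP => g /imfsetP[b /= bB ->].
exact: mem_fset_mulg.
Qed.

(** The translates K k^-1 w, for k in [K], contain w and have distinct translating elements. This is
    the covering hypothesis of [shearer]. *)
Lemma leq_card_translates (G : groupType) (K W : {fset G}) (w : G) :
  w \in W ->
  (#|` K| <= #|[pred g : fset_mulg (fset_invg K) W |
                 w \in fset_mulg K [fset val g]%fset]|)%N.
Proof.
move=> wW; set P := [pred g : _ | _].
have inI (k : K) : ((fsval k)^-1 * w)%g \in fset_mulg (fset_invg K) W.
  by rewrite mem_fset_mulg// mem_fset_invg// fsvalP.
pose f (k : K) : fset_mulg (fset_invg K) W := [` inI k]%fset.
have finj : injective f.
  by move=> k k' /(congr1 val)/= /mulIg /invg_inj /val_inj.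
rewrite cardfE -(card_codom finj); apply: subset_leq_card.
apply/fintype.subsetP => _ /codomP[k ->]; rewrite inE /=.
apply/fset_mulgP; exists (fsval k), ((fsval k)^-1 * w)%g.
by rewrite fsvalP inE eqxx mulgA mulgV mul1g.
Qed.

Section PatternEntropy.
Variables (R : realType) (G : groupType) (T : Type) (act : G -> T -> T).
Variables (F : nat -> {fset G}).
Hypothesis folnerF : folner_sequence R F.

(** The convention of the shift: acting by [g] moves the window K g to K. *)
Definition equivariant_label (B : Type) (l : T -> G -> B) :=
  forall g x h, l (act g x) h = l x (h * g)%g.

Definition pattern_card (B : finType) (l : T -> G -> B) (E : {fset G}) : nat :=
  image_card [set: T] (pattern l E).

Definition pattern_rate (B : finType) (l : T -> G -> B) (E : {fset G}) : R :=
  ln (pattern_card l E)%:R / #|` E|%:R.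

(** Taken as an infimum so that any single set bounds it from above; for equivariant labels
    [pattern_entropy_cvg] identifies it with the limit along [F]. *)
Definition pattern_entropy (B : finType) (l : T -> G -> B) : R :=
  inf [set pattern_rate l K | K in [set K : {fset G} | K != fset0]].

Lemma pattern_rate_ge0 (B : finType) (l : T -> G -> B) (E : {fset G}) :
  0 <= pattern_rate l E.
Proof.
rewrite /pattern_rate divr_ge0//.
by case: pattern_card => [|n]; [rewrite ln0|rewrite ln_ge0// ler1n].
Qed.

Lemma has_lbound_pattern_rate (B : finType) (l : T -> G -> B) :
  has_lbound [set pattern_rate l K | K in [set K : {fset G} | K != fset0]].
Proof. by exists 0 => _ [K _ <-]; exact: pattern_rate_ge0. Qed.

Lemma pattern_entropy_le (B : finType) (l : T -> G -> B) (K : {fset G}) :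
  K != fset0 -> pattern_entropy l <= pattern_rate l K.
Proof.
by move=> K0; apply: ge_inf; [exact: has_lbound_pattern_rate|exists K].
Qed.

Lemma pattern_entropy_ge (B : finType) (l : T -> G -> B) (w : R) :
  (forall K, K != fset0 -> w <= pattern_rate l K) -> w <= pattern_entropy l.
Proof.
move=> wle; apply: lb_le_inf; last by move=> _ [K K0 <-]; exact: wle.
exists (pattern_rate l [fset 1%g]%fset); exists [fset 1%g]%fset => //=.
by apply/fset0Pn; exists 1%g; rewrite inE.
Qed.

Lemma pattern_entropy_ge0 (B : finType) (l : T -> G -> B) :
  0 <= pattern_entropy l.
Proof. by apply: pattern_entropy_ge => K _; exact: pattern_rate_ge0. Qed.

(** Logarithm of [shearer] for the translates K g with g in K^-1 W. The set [S] is arbitrary so that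
    the bound also serves on fibres. *)
Lemma ln_image_card_le (B : finType) (l : T -> G -> B) (S : set T)
    (K W : {fset G}) (b : nat) :
  K != fset0 -> (0 < b)%N ->
  (forall g, g \in fset_mulg (fset_invg K) W ->
    image_card S (pattern l (fset_mulg K [fset g]%fset)) <= b)%N ->
  ln (image_card S (pattern l W))%:R <=
    #|` fset_mulg (fset_invg K) W|%:R * (ln b%:R / #|` K|%:R) :> R.
Proof.
move=> K0 b0 cb; set I := fset_mulg _ W.
have k0 : (0 < #|` K|)%N by rewrite cardfs_gt0.
have [->|] := eqVneq (image_card S (pattern l W)) 0%N.
  by rewrite ln0// mulr_ge0// divr_ge0// ln_ge0// ler1n.
rewrite -lt0n => c0; rewrite mulrA ler_pdivlMr ?ltr0n//.
rewrite -[in X in X <= _]mulrC mulr_natl mulr_natl -!lnXn ?ltr0n//.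
rewrite ler_ln ?posrE ?exprn_gt0 ?ltr0n//.
apply: le_trans (@shearer R G T B l I
  (fun g => fset_mulg K [fset val g]%fset) #|` K| W S k0 _) _.
  by move=> w wW; exact: leq_card_translates.
rewrite cardfE -prodr_const; apply: ler_prod => g _.
by rewrite ler0n ler_nat cb// fsvalP.
Qed.

Lemma image_card_translate (B : finType) (l : T -> G -> B) (S S' : set T)
    (K : {fset G}) (g : G) :
  equivariant_label l -> (forall x, S x -> S' (act g x)) ->
  (image_card S (pattern l (fset_mulg K [fset g]%fset)) <=
   image_card S' (pattern l K))%N.
Proof.
move=> eql SS'; apply: (@leq_trans (image_card S (pattern l K \o act g))).
  apply: image_card_factor => // x y _ _ /patternP exy.
  apply/patternP => h /fset_mulgP[k [e [kK]]]; rewrite inE => /eqP -> ->.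
  by rewrite -!eql; exact: exy.
apply: subset_leq_card; apply/fintype.subsetP => v.
by rewrite !inE => -[x /SS' Sx <-]; exists (act g x).
Qed.

(** For W = F n the ratio of |K^-1 W| to |W| tends to 1, so in the limit this bounds the rate along
    [F] by the rate of any [K]. *)
Lemma ln_pattern_card_le (B : finType) (l : T -> G -> B) (K W : {fset G}) :
  equivariant_label l -> K != fset0 ->
  ln (pattern_card l W)%:R <=
    #|` fset_mulg (fset_invg K) W|%:R * pattern_rate l K.
Proof.
move=> eql K0; have [T0|T0] := pselect ([set: T] !=set0); last first.
  suff -> : pattern_card l W = 0%N by rewrite ln0// mulr_ge0// pattern_rate_ge0.
  apply: fintype.eq_card0 => v; apply/negbTE/negP; rewrite inE => -[x _ _].
  by apply: T0; exists x.
apply: ln_image_card_le => // [|g _]; first exact: image_card_gt0.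
exact: image_card_translate.
Qed.

Lemma folner_ratio_cvg (K : {fset G}) : K != fset0 ->
  (fun n => #|` fset_mulg K (F n)|%:R / #|` F n|%:R : R) @ \oo --> (1 : R).
Proof.
move=> K0; case: folnerF => F0 folK.
apply: (@squeeze_cvgr _ _ _ _ (fun=> 1) (fun n => 1 +
   #|` fset_symdiff (fset_mulg K (F n)) (F n)|%:R / #|` F n|%:R)).
- apply: nearW => n; have Fn0 : (0 < #|` F n|)%N by rewrite cardfs_gt0.
  rewrite ler_pdivlMr ?ltr0n// mul1r ler_nat leq_card_fset_mulg//=.
  rewrite -[X in X + _](@mulfV _ (#|` F n|%:R)) ?pnatr_eq0 -?lt0n// -mulrDl.
  rewrite -natrD ler_pM2r ?invr_gt0 ?ltr0n// ler_nat.
  apply: (@leq_trans #|` (F n `|` fset_symdiff (fset_mulg K (F n)) (F n))%fset|).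
    apply: fsubset_leq_card; apply/fsubsetP => g gK; rewrite !inE gK /=.
    by case: (g \in F n).
  by rewrite cardfsU leq_subr.
- exact: cvg_cst.
- by rewrite -[X in _ --> X]addr0; apply: cvgD; [exact: cvg_cst|exact: folK].
Qed.

Lemma folner_le (K : {fset G}) (w r : R) : K != fset0 ->
  (forall n, w <= r * (#|` fset_mulg K (F n)|%:R / #|` F n|%:R)) -> w <= r.
Proof.
move=> K0 wr; rewrite -[r]mulr1.
apply: (@ler_cvg_to _ \oo _ _ (fun=> w) _ w).
- exact: cvg_cst.
- by apply: cvgM; [exact: cvg_cst|exact: folner_ratio_cvg K0].
- apply: nearW => n; exact: wr.
Qed.


(** The infimum rule. Each [F n] is nonempty, so its rate is at least the infimum; a set [K] nearly
    attaining the infimum bounds the rates from above. *)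
Lemma pattern_entropy_cvg (B : finType) (l : T -> G -> B) :
  equivariant_label l ->
  (fun n => pattern_rate l (F n)) @ \oo --> pattern_entropy l.
Proof.
move=> eql; have [F0 _] := folnerF.
apply/cvgrPdist_le => e e0.
have [_ [K K0 <-] Ke] := @inf_adherent R _ e e0 (conj
  (ex_intro _ (pattern_rate l [fset 1%g]%fset)
    (ex_intro2 _ _ [fset 1%g]%fset (introT (fset0Pn _)
      (ex_intro _ 1%g (fset11 1%g))) erefl))
  (has_lbound_pattern_rate l)).
have /cvgr_lt/(_ _ Ke) : (fun n => pattern_rate l K *
    (#|` fset_mulg (fset_invg K) (F n)|%:R / #|` F n|%:R)) @ \oo -->
    pattern_rate l K.
  rewrite -[X in _ --> X]mulr1; apply: cvgM; first exact: cvg_cst.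
  exact/folner_ratio_cvg/fset_invg_neq0.
apply: filterS => n ltn; rewrite ler_distlC; apply/andP; split.
  by rewrite lerBlDr (le_trans (pattern_entropy_le l (F0 n)))// lerDl ltW.
apply: le_trans (ltW ltn); rewrite {1}/pattern_rate mulrA.
by rewrite ler_wpM2r// mulrC ln_pattern_card_le.
Qed.

(** Enlarging [F n] by a fixed window [K] is harmless: L^-1 K F n still has size asymptotic to that
    of [F n]. *)
Lemma lim_le_pattern_entropy (B : finType) (l : T -> G -> B) (K : {fset G})
    (v : nat -> R) :
  equivariant_label l -> K != fset0 ->
  (forall n, v n <= ln (pattern_card l (fset_mulg K (F n)))%:R / #|` F n|%:R) ->
  limn v <= pattern_entropy l.
Proof.
(* A divergent [v] has the default limit 0, which the nonnegative entropy also bounds. *)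
move=> eql K0 vle; have [cv|ncv] := pselect (cvgn v); last first.
  rewrite (_ : limn v = 0) ?pattern_entropy_ge0//.
  by apply: xgetPN => x vx; apply: ncv; exact: cvgP vx.
apply: pattern_entropy_ge => L L0; rewrite -[X in _ <= X]mulr1.
apply: (@ler_cvg_to _ \oo _ _ v (fun n => pattern_rate l L *
  (#|` fset_mulg (fset_mulg (fset_invg L) K) (F n)|%:R / #|` F n|%:R))
  _ (pattern_rate l L * 1)) => //; last first.
- apply: nearW => n; apply: le_trans (vle n) _.
  rewrite mulrA ler_wpM2r// mulrC -fset_mulgA.
  exact: ln_pattern_card_le.
- apply: cvgM; first exact: cvg_cst.
  exact/folner_ratio_cvg/fset_mulg_neq0/K0/fset_invg_neq0.
Qed.

(** Counts on a common set are submultiplicative. Infima need not be attained on a common set, so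
    the inequality is passed to the limit along [F]. *)
Lemma pattern_entropy_subadd (B B1 B2 : finType) (l : T -> G -> B)
    (l1 : T -> G -> B1) (l2 : T -> G -> B2) :
  [set: T] !=set0 ->
  equivariant_label l -> equivariant_label l1 -> equivariant_label l2 ->
  (forall x y g, l1 x g = l1 y g -> l2 x g = l2 y g -> l x g = l y g) ->
  pattern_entropy l <= pattern_entropy l1 + pattern_entropy l2.
Proof.
move=> T0 eql eql1 eql2 det; have [F0 _] := folnerF.
apply: (@ler_cvg_to _ \oo _ _ (fun n => pattern_rate l (F n))
  (fun n => pattern_rate l1 (F n) + pattern_rate l2 (F n))).
- exact: pattern_entropy_cvg.
- by apply: cvgD; exact: pattern_entropy_cvg.
apply: nearW => n; rewrite /pattern_rate -mulrDl ler_wpM2r//.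
rewrite -lnM ?posrE ?ltr0n ?image_card_gt0// -natrM.
rewrite ler_ln ?posrE ?ltr0n ?muln_gt0 ?image_card_gt0// ler_nat.
apply: image_card_prod => x y _ _ /patternP e1 /patternP e2; apply/patternP => g gF.
by apply: det; [exact: e1|exact: e2].
Qed.

(* Conditionally on the pattern of [l'] over [E^-1 F n], each
   translate of [E] carries at most [b] patterns of [l]; Shearer's inequality on
   the fibres turns this into a bound on the relative entropy. *)
Lemma pattern_entropy_relative (B B' : finType) (l : T -> G -> B)
    (l' : T -> G -> B') (E : {fset G}) (b : nat) :
  [set: T] !=set0 ->
  equivariant_label l -> equivariant_label l' -> E != fset0 -> (0 < b)%N ->
  (forall c, image_card [set x | l' x 1%g = c] (pattern l E) <= b)%N ->
  pattern_entropy l <= pattern_entropy l' + ln b%:R / #|` E|%:R.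
Proof.
move=> T0 eql eql' E0 b0 cb; have [F0 _] := folnerF.
rewrite -lerBlDr; apply: pattern_entropy_ge => L L0; rewrite lerBlDr.
apply: (@folner_le (fset_mulg (fset_invg L) (fset_invg E))).
  by rewrite fset_mulg_neq0// fset_invg_neq0.
move=> n; apply: le_trans (pattern_entropy_le l (F0 n)) _.
set W := fset_mulg (fset_invg E) (F n).
(* Bounding |W| by |L^-1 W| gives both terms the same ratio, the one that [folner_le] removes. *)
have WL : (#|` W| <= #|` fset_mulg (fset_invg L) W|)%N.
  by rewrite leq_card_fset_mulg// fset_invg_neq0.
rewrite /pattern_rate mulrA ler_wpM2r// -fset_mulgA -/W.
set beta := #|` W|%:R * (ln b%:R / #|` E|%:R) : R.
have fibre v : (image_card [set x | pattern l' W x = v] (pattern l (F n)))%:R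
    <= expR beta.
  have [->|] := eqVneq (image_card [set x | pattern l' W x = v]
    (pattern l (F n))) 0%N; first by rewrite expR_ge0.
  rewrite -lt0n => c0; rewrite -ler_ln ?posrE ?expR_gt0 ?ltr0n// expRK.
  apply: ln_image_card_le => // g gW.
  (* The hypothesis [cb] concerns the site 1; acting by [g] brings the site [g] of [W] there. *)
  apply: leq_trans (cb (v [` gW]%fset)); apply: image_card_translate => // x /= <-.
  by rewrite ffunE eql' mul1g.
have le_prod : (pattern_card l (F n))%:R <= (pattern_card l' W)%:R * expR beta.
  apply: (@le_trans _ _ (\sum_(v | `[< (pattern l' W @` [set: T]) v >])
      (image_card ([set: T] `&` [set x | pattern l' W x = v])
        (pattern l (F n)))%:R)).
    by rewrite -natr_sum ler_nat; exact: image_card_le_sum.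
  rewrite /pattern_card /image_card mulr_natl -sumr_const; apply: ler_sum => v _.
  by rewrite setTI; exact: fibre.
apply: (@le_trans _ _ (ln (pattern_card l' W)%:R + beta)).
  rewrite -[beta]expRK -lnM ?posrE ?expR_gt0 ?ltr0n ?image_card_gt0//.
  by rewrite ler_ln// posrE ?mulr_gt0 ?expR_gt0 ?ltr0n ?image_card_gt0.
rewrite mulrDl; apply: lerD; first by rewrite mulrC; exact: ln_pattern_card_le.
by rewrite mulrC ler_wpM2r ?ler_nat// divr_ge0// ln_ge0// ler1n.
Qed.

Lemma pattern_entropy_const (B : finType) (l : T -> G -> B) (c : B) :
  (forall x g, l x g = c) -> pattern_entropy l = 0.
Proof.
move=> lc; apply/eqP; rewrite eq_le pattern_entropy_ge0 andbT.
have E0 : [fset 1%g]%fset != fset0 :> {fset G} by rewrite -cardfs_gt0 cardfs1.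
apply: le_trans (pattern_entropy_le l E0) _.
rewrite /pattern_rate mulr_le0_ge0// ln_le0// lern1.
apply: (@leq_trans (image_card [set: T] (fun=> tt))).
  by apply: image_card_factor => // x y _ _ _; apply/patternP => g _; rewrite !lc.
by rewrite /image_card (leq_trans (max_card _))// card_unit.
Qed.

End PatternEntropy.

(** * Revealing good patterns *)

Lemma exists_quotient_le (R : realType) (c e : R) : 0 <= c -> 0 < e ->
  exists2 n, (0 < n)%N & c / n%:R <= e.
Proof.
move=> c0 e0; exists (Num.bound (c / e)).+1 => //.
rewrite ler_pdivrMr ?ltr0n// mulrC -ler_pdivrMr//.
apply: le_trans (ltW (archi_boundP (divr_ge0 c0 (ltW e0)))) _.
by rewrite ler_nat.
Qed.

Lemma exists_ln_quotient_le (R : realType) (e : R) : 0 < e ->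
  exists N : nat, ln N.+2%:R / N.+1%:R <= e.
Proof.
move=> e0; have [n n0 ne] := @exists_quotient_le R 2 e (ler0n R 2) e0.
(* Now N + 2 = (n + 1)^2 and N + 1 = n (n + 2), so ln (n + 1) <= n bounds the quotient by 2 / n. *)
exists (n * n.+2).-1; rewrite prednK ?muln_gt0 ?n0//.
have -> : (n * n.+2).+1 = (n.+1 ^ 2)%N by rewrite -mulnn; lia.
rewrite natrX lnXn ?ltr0n//.
apply: le_trans ne; rewrite natrM ler_pdivrMr ?mulr_gt0 ?ltr0n//.
rewrite mulrA divfK ?pnatr_eq0 -?lt0n//.
rewrite -[ln _ *+ 2]mulr_natl ler_pM2l//.
apply: (@le_trans _ _ n%:R); last by rewrite ler_nat; lia.
by rewrite -natr1 addrC le_ln1Dx// (lt_le_trans _ (ler0n _ n)).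
Qed.

Lemma infinite_fset_notin (G : choiceType) (E : {fset G}) :
  infinite_set [set: G] -> exists g, g \notin E.
Proof.
move=> infG; apply: contrapT => nex; apply: infG.
apply: (@sub_finite_set _ _ [set` E]); last exact: finite_fset.
by move=> g _ /=; apply: contrapT => /negP gE; apply: nex; exists g.
Qed.

(** Greedy construction: for [g] outside K D D^-1 the set g D is disjoint from K D. Avoiding [K] too
    makes the case of empty [D] produce a set of any given size. *)
Lemma exists_fset_card_mulg (G : groupType) (D : {fset G}) (n : nat) :
  infinite_set [set: G] ->
  exists K : {fset G}, #|` K| = n /\ #|` fset_mulg K D| = (n * #|` D|)%N.
Proof.
move=> infG; elim: n => [|n [K [Kn KDn]]].
  exists fset0; split=> //; rewrite mul0n; apply/eqP; rewrite cardfs_eq0.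
  by apply/eqP/fsetP => g; rewrite inE; apply/negP => /fset_mulgP[k [d []]].
have [g gK] := infinite_fset_notin
  (K `|` fset_mulg (fset_mulg K D) (fset_invg D))%fset infG.
move: gK; rewrite inE negb_or => /andP[gK gKD].
exists (g |` K)%fset; split; first by rewrite cardfsU1 gK Kn.
have -> : fset_mulg (g |` K)%fset D =
    ([fset (g * d)%g | d in D] `|` fset_mulg K D)%fset.
  apply/fsetP => h; rewrite inE; apply/fset_mulgP/orP.
    move=> [k [d [+ dD ->]]]; rewrite !inE => /predU1P[->|kK].
      by left; apply/imfsetP; exists d.
    by right; exact: mem_fset_mulg.
  move=> [/imfsetP[d /= dD ->]|/fset_mulgP[k [d [kK dD ->]]]].
    by exists g, d; rewrite !inE eqxx.
  by exists k, d; rewrite !inE kK orbT.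
rewrite cardfsU (_ : _ `&` _ = fset0)%fset ?cardfs0 ?subn0; last first.
  apply/fsetP => h; rewrite !inE; apply/negP => /andP[/imfsetP[d /= dD ->]] gdKD.
  move/negP: gKD; apply; rewrite -[g](mulgK d).
  by rewrite mem_fset_mulg// mem_fset_invg.
by rewrite card_imfset ?KDn ?mulSn//; exact: mulgI.
Qed.

Section Reveal.
Variables (R : realType) (G : groupType) (T : Type) (act : G -> T -> T).
Variables (F : nat -> {fset G}).
Hypothesis folnerF : folner_sequence R F.
Hypothesis T0 : [set: T] !=set0.
Variables (A : finType) (l : T -> G -> A).
Hypothesis eql : equivariant_label act l.

(** A sliding block code with window [K]; every site without a listed pattern carries the blank
    [None]. *)
Definition reveal (K : {fset G}) (P : seq {ffun K -> A}) (x : T) (g : G) :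
    option {ffun K -> A} :=
  let w := [ffun k => l x (val k * g)%g] in if w \in P then Some w else None.

Lemma reveal_equivariant (K : {fset G}) (P : seq {ffun K -> A}) :
  equivariant_label act (reveal P).
Proof.
move=> g x h; rewrite /reveal.
suff -> : [ffun k : K => l (act g x) (val k * h)%g] =
          [ffun k : K => l x (val k * (h * g))%g] by [].
by apply/ffunP => k; rewrite !ffunE eql mulgA.
Qed.

Lemma reveal_nil_entropy (K : {fset G}) :
  pattern_entropy R (reveal (Nil {ffun K -> A})) = 0.
Proof. exact: (@pattern_entropy_const _ _ _ _ _ None). Qed.

(** At each site the two labels on the right determine the one on the left. One more pattern thus
    costs at most the entropy of its own occurrences. *)
Lemma reveal_cons_entropy (K : {fset G}) (p : {ffun K -> A})
    (P : seq {ffun K -> A}) :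
  pattern_entropy R (reveal (p :: P)) <=
  pattern_entropy R (reveal P) + pattern_entropy R (reveal [:: p]).
Proof.
apply: (pattern_entropy_subadd folnerF T0 (@reveal_equivariant _ _)
  (@reveal_equivariant _ _) (@reveal_equivariant _ _)).
move=> x y g; rewrite /reveal !inE.
set u := [ffun k => l x _]; set v := [ffun k => l y _].
by case: (eqVneq u p) => [->|up]; case: (eqVneq v p) => [->|vp].
Qed.

Section Rows.
Variables D K : {fset G}.
Local Notation KD := (fset_mulg K D).

Definition row_pattern (p : {ffun KD -> A}) (d : D) : {ffun K -> A} :=
  [ffun k => p [` mem_fset_mulg (fsvalP k) (fsvalP d)]%fset].

Definition row_count (p : {ffun KD -> A}) : nat :=
  image_card [set: D] (row_pattern p).

(* An occurrence of [p] at [d^-1] forces the pattern on [K] to be the row of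
   [p] at [d], so among sites [d^-1] with pairwise distinct rows at most one
   carries [p]. *)
Lemma row_pattern_reveal (p : {ffun KD -> A}) (x : T) (d : D) :
  reveal [:: p] x (fsval d)^-1%g = Some p -> row_pattern p d = pattern l K x.
Proof.
rewrite /reveal inE; case: eqP => // px _; apply/ffunP => k; rewrite !ffunE.
by rewrite -[in LHS]px ffunE /= -mulgA mulgV mulg1.
Qed.

(** Take for [E] the inverses of N + 1 elements of [D] with distinct rows. The label on [E] shows at
    most one occurrence, hence has at most N + 2 patterns. *)
Lemma reveal1_entropy (p : {ffun KD -> A}) (N : nat) : (N < row_count p)%N ->
  pattern_entropy R (reveal [:: p]) <= ln N.+2%:R / N.+1%:R.
Proof.
move=> /card_geqP[s [us ss sP]].
have [d0 _] : exists d : D, True.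
  case: s ss sP {us} => // w s _ /(_ w); rewrite inE eqxx inE => /(_ isT).
  by case=> d; exists d.
have dP (w : {ffun K -> A}) : exists d, w \in s -> row_pattern p d = w.
  have [/sP|] := boolP (w \in s); last by exists d0.
  by rewrite inE => -[d _ <-]; exists d.
have [dw dwP] := choice dP.
pose E : {fset G} := [fset (fsval (dw w))^-1%g | w in s]%fset.
have Ecard : #|` E| = N.+1.
  rewrite card_in_imfset/=; last first.
    move=> w w' ws ws' /invg_inj /val_inj eww'.
    by rewrite -[w]dwP// eww' dwP.
  by rewrite /= undup_id.
have E0 : E != fset0 by rewrite -cardfs_gt0 Ecard.
apply: le_trans (pattern_entropy_le R _ E0) _.
rewrite /pattern_rate Ecard ler_wpM2r//.
rewrite ler_ln ?posrE ?ltr0n ?image_card_gt0// ler_nat.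
(* [o x] names the row whose site carries [p], or is [None]. It determines the label on [E], since
   occurrences at two sites would force equal rows. *)
pose o x : option (seq_sub s) :=
  [pick w : seq_sub s | reveal [:: p] x (fsval (dw (val w)))^-1%g == Some p].
apply: (@leq_trans (image_card [set: T] o)); last first.
  by rewrite (leq_trans (max_card _))// card_option card_seq_sub// ss.
apply: image_card_factor => // x y _ _ oxy; apply/patternP => g.
move=> /imfsetP[w /= ws ->].
have val01 z : reveal [:: p] z (fsval (dw w))^-1%g =
    if o z is Some w' then if w == val w' then Some p else None else None.
  rewrite /o; case: pickP => [w' /eqP w'z|nz].
    have [->//|ww'] := eqVneq w (val w').
    rewrite /reveal inE; case: eqP => // pw.
    have /row_pattern_reveal : reveal [:: p] z (fsval (dw w))^-1%g = Some p.
      by rewrite /reveal inE pw eqxx.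
    rewrite -(row_pattern_reveal w'z) !dwP ?(valP w')// => e.
    by rewrite e eqxx in ww'.
  rewrite /reveal inE; case: eqP => // pw.
  by have := nz (SeqSub ws); rewrite /= /reveal inE pw !eqxx.
by rewrite !val01 oxy.
Qed.

(** A bad pattern is encoded by the list of its distinct rows and, for each d in [D], the index of
    its row in that list. *)
Lemma row_count_le_card (N : nat) (a0 : A) :
  (#|[pred p | row_count p <= N]| <=
   N.+1 ^ #|` D| * (#|A| ^ #|` K|) ^ N.+1)%N.
Proof.
pose rows (p : {ffun KD -> A}) :=
  enum [pred v | `[< (row_pattern p @` [set: D]) v >]].
(* At most [N] rows are listed; ['I_N.+1] is nonempty also for N = 0, as [inord] requires, and the
   spare entries are filled with the constant pattern [a0]. *)
pose code p : {ffun D -> 'I_N.+1} * {ffun 'I_N.+1 -> {ffun K -> A}} :=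
  ([ffun d => inord (index (row_pattern p d) (rows p))],
   [ffun i : 'I_N.+1 => nth [ffun=> a0] (rows p) i]).
have codeP p : (row_count p <= N)%N ->
    forall d, (code p).2 ((code p).1 d) = row_pattern p d.
  move=> pN d; rewrite !ffunE /=.
  have din : row_pattern p d \in rows p by rewrite mem_enum inE; exists d.
  rewrite inordK ?nth_index// ltnS; apply: leq_trans pN.
  by rewrite /row_count /image_card cardE ltnW// index_mem.
have cinj : {in [pred p | row_count p <= N]%N &, injective code}.
  move=> p q; rewrite !inE => pN qN pq; apply/ffunP => -[g gKD].
  have /fset_mulgP[k [d [kK dD gkd]]] := gKD.
  have := codeP p pN [` dD]%fset; rewrite pq codeP// => /ffunP/(_ [` kK]%fset).
  rewrite !ffunE /= => e; apply/esym.
  by congr (_ = _): e; congr (fun_of_fin _ _); apply: val_inj.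
rewrite -(card_in_image cinj) (leq_trans (max_card _))//.
by rewrite card_prod !card_ffun card_ord !cardfE.
Qed.

(** Given the revealed label at 1, the pattern on [KD] is either known or bad, so
    [pattern_entropy_relative] applies with the number of bad patterns. As |KD| = |K| |D|, its
    logarithm splits into the two quotients. *)
Lemma reveal_good_entropy (N : nat) (P : seq {ffun KD -> A}) :
  K != fset0 -> D != fset0 ->
  (forall p, (N < row_count p)%N -> p \in P) ->
  #|` KD| = (#|` K| * #|` D|)%N ->
  pattern_entropy R l <= pattern_entropy R (reveal P) +
    (ln N.+1%:R / #|` K|%:R + N.+1%:R * ln #|A|%:R / #|` D|%:R).
Proof.
move=> K0 D0 goodP KDcard; have [x0 _] := T0; pose a0 := l x0 1%g.
set b := (N.+1 ^ #|` D| * (#|A| ^ #|` K|) ^ N.+1)%N.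
have A0 : (0 < #|A|)%N by apply/card_gt0P; exists a0.
have b0 : (0 < b)%N by rewrite muln_gt0 !expn_gt0 A0.
have KD0 : KD != fset0 by rewrite fset_mulg_neq0.
have d0 : #|` D|%:R != 0 :> R by rewrite pnatr_eq0 cardfs_eq0.
have k0 : #|` K|%:R != 0 :> R by rewrite pnatr_eq0 cardfs_eq0.
have <- : ln b%:R / #|` KD|%:R =
    ln N.+1%:R / #|` K|%:R + N.+1%:R * ln #|A|%:R / #|` D|%:R :> R.
  rewrite KDcard /b !natrM !natrX lnM ?posrE ?exprn_gt0 ?ltr0n//.
  rewrite !lnXn ?exprn_gt0 ?ltr0n//.
  rewrite -(mulr_natl (ln N.+1%:R)) -(mulr_natl (ln #|A|%:R)).
  rewrite -(mulr_natl (_ * ln #|A|%:R)).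
  by field; rewrite k0 d0.
apply: (pattern_entropy_relative folnerF) => //; first exact: reveal_equivariant.
have pat1 x : [ffun k : KD => l x (val k * 1)%g] = pattern l KD x.
  by apply/ffunP => k; rewrite !ffunE mulg1.
case=> [w|].
  apply: (@leq_trans 1) => //.
  apply: (@leq_trans (image_card [set: T] (fun=> tt))).
    apply: image_card_factor => // x y /=.
    rewrite /reveal !pat1; case: ifP => // _ [->]; case: ifP => // _ [->].
    by [].
  by rewrite /image_card (leq_trans (max_card _))// card_unit.
(* The blank means that the pattern is not in [P], hence bad. *)
apply: leq_trans (row_count_le_card N a0).
apply: subset_leq_card; apply/fintype.subsetP => v; rewrite !inE => -[x /=].
rewrite /reveal pat1; case: ifP => // /negbT nP _ <-.
by rewrite leqNgt; apply: contra nP; exact: goodP.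
Qed.

End Rows.

(** A discrete intermediate value argument: drop patterns from the head until the entropy would fall
    below t - e. The last list before that has entropy between t - e and t, as one pattern adds at
    most [e]. *)
Lemma reveal_chain (K : {fset G}) (e t : R) (P : seq {ffun K -> A}) :
  0 < e -> 0 <= t -> t - e <= pattern_entropy R (reveal P) ->
  (forall p, p \in P -> pattern_entropy R (reveal [:: p]) <= e) ->
  exists Q : seq {ffun K -> A}, `|pattern_entropy R (reveal Q) - t| <= e.
Proof.
move=> e0 t0; elim: P => [|p P IH] teP small.
  exists [::]; move: teP; rewrite reveal_nil_entropy sub0r normrN ger0_norm//.
  by rewrite subr_le0.
have [tP|Pt] := leP (t - e) (pattern_entropy R (reveal P)).
  by apply: IH tP _ => q qP; apply: small; rewrite inE qP orbT.
exists (p :: P); rewrite ler_distl teP /=.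
have := reveal_cons_entropy p P; have := small p (mem_head _ _).
lra.
Qed.

Lemma exists_reveal_entropy (e t : R) : infinite_set [set: G] ->
  0 < e -> 0 <= t <= pattern_entropy R l ->
  exists (K : {fset G}) (P : seq {ffun K -> A}),
    `|pattern_entropy R (reveal P) - t| <= e.
Proof.
move=> infG e0 /andP[t0 tl].
(* Order of choice: [N] makes single patterns cheap, then the sizes [d] and [k], depending on [N],
   make each error term at most e / 2. [D] precedes [K] because the product must be direct. *)
have [N Ne] : exists N : nat, ln N.+2%:R / N.+1%:R <= e :> R.
  exact: exists_ln_quotient_le.
have [x0 _] := T0.
have lnA0 : 0 <= ln #|A|%:R :> R.
  by rewrite ln_ge0// ler1n; apply/card_gt0P; exists (l x0 1%g).
have [d d0 de] : exists2 d, (0 < d)%N & N.+1%:R * ln #|A|%:R / d%:R <= e / 2 :> R.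
  by apply: exists_quotient_le; [exact: mulr_ge0|exact: divr_gt0].
have [k k0 ke] : exists2 k, (0 < k)%N & ln N.+1%:R / k%:R <= e / 2 :> R.
  by apply: exists_quotient_le; [rewrite ln_ge0// ler1n|exact: divr_gt0].
have [D [Dd _]] := exists_fset_card_mulg fset0 d infG.
have [K [Kk KDk]] := exists_fset_card_mulg D k infG.
pose P := enum [pred p | N < row_count (D := D) (K := K) p]%N.
have := @reveal_good_entropy D K N P.
rewrite -!cardfs_gt0 Dd Kk KDk Dd => /(_ k0 d0 _ erefl) goodP.
exists (fset_mulg K D); apply: (@reveal_chain _ e t P) => // [|p].
  rewrite lerBlDr; apply: le_trans tl (le_trans (goodP _) _) => [p pN|].
    by rewrite mem_enum.
  by rewrite lerD2l [leRHS](splitr e); exact: lerD.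
by rewrite mem_enum => /reveal1_entropy /le_trans; apply.
Qed.

End Reveal.

(** * Topological entropy of subshifts *)

Section Subcovers.
Variables (X : Type) (U : set (set X)).

Lemma min_subcoverP (n : nat) : subcover_cards U n ->
  subcover_cards U (min_subcover U) /\ (min_subcover U <= n)%N.
Proof.
move=> Un; have exP : exists n, `[< subcover_cards U n >] by exists n; apply/asboolP.
have [m /asboolP Um minm] := ex_minnP exP.
have lbm : (subcover_cards U `&` lbound (subcover_cards U)) m.
  by split=> // k /asboolP Uk; rewrite leEnat minm.
have [Umin lbmin] := xgetPex 0%N (ex_intro _ m lbm).
by split=> //; have := lbmin n Un; rewrite leEnat.
Qed.

Lemma subcover_cards_image (V : finType) (S : {pred V}) (C : V -> set X) :
  (forall v, v \in S -> U (C v)) -> (forall x, exists2 v, v \in S & C v x) ->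
  exists2 n, subcover_cards U n & (n <= #|S|)%N.
Proof.
move=> CU Ccov; pose W := [fset C v | v in S]%fset.
exists #|` W|; last by rewrite (leq_trans (leq_imfset_card _ _ _))// -cardE.
exists [set` W]; split.
- by move=> _ /imfsetP[v /= vS ->]; exact: CU.
- rewrite -subTset => x _; have [v vS Cvx] := Ccov x.
  by exists (C v) => //=; apply/imfsetP; exists v.
- exact/card_eq_fsetP.
Qed.

(** No member of [U] contains two of the points [x v], so a subcover needs a separate member for
    each. *)
Lemma subcover_cards_ge (V : finType) (S : {pred V}) (x : V -> X) (n : nat) :
  (forall A v w, U A -> v \in S -> w \in S -> A (x v) -> A (x w) -> v = w) ->
  subcover_cards U n -> (#|S| <= n)%N.
Proof.
move=> sepU [W [WU Wcov Wn]].
have /choice[A AP] : forall v, exists A, W A /\ A (x v).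
  by move=> v; have : [set: X] (x v) by []; rewrite -Wcov => -[A WA Ax]; exists A.
have finW : finite_set W by apply/finite_setP; exists n.
rewrite -(card_fset_set Wn).
have Ainj : {in S &, injective A}.
  move=> v w vS wS Avw; have [WA Av] := AP v; have [_ Aw] := AP w.
  by apply: (sepU (A v)) => //; [exact: WU|rewrite Avw].
rewrite cardE -(card_in_imfset imfset_key Ainj).
apply/fsubset_leq_card/fsubsetP => _ /imfsetP[v /= vS ->].
by rewrite in_fset_set// inE; have [] := AP v.
Qed.
End Subcovers.

Section DynJoin.
Variables (G : groupType) (X : Type) (act : G -> X -> X).
Hypothesis actK : forall g x, act g^-1%g (act g x) = x.
Hypothesis X0 : [set: X] !=set0.
Variables (B : finType) (l : X -> G -> B).
Hypothesis eql : equivariant_label act l.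

Lemma exists_pattern_preimage (E : {fset G}) (v : {ffun E -> B}) :
  exists x, v \in [pred v | `[< (pattern l E @` [set: X]) v >]] ->
    pattern l E x = v.
Proof.
have [x0 _] := X0.
have [|nv] := boolP (v \in [pred v | `[< (pattern l E @` [set: X]) v >]]).
  by rewrite inE => -[x _ <-]; exists x.
by exists x0.
Qed.

(** If the pattern on [K] selects a member of [U], the pattern on K E selects one for every
    translate by g in [E]. One cell of the join per pattern on K E then suffices. *)
Lemma dyn_join_subcover (U : set (set X)) (K E : {fset G}) :
  (forall x, exists2 A, U A &
    forall y, pattern l K y = pattern l K x -> A y) ->
  exists2 n, subcover_cards (dyn_join act E U) n &
    (n <= pattern_card l (fset_mulg K E))%N.
Proof.
move=> covU.
have /choice[A AP] : forall x, exists A, U A /\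
    forall y, pattern l K y = pattern l K x -> A y.
  by move=> x; have [A UA KA] := covU x; exists A.
pose P := [pred v | `[< (pattern l (fset_mulg K E) @` [set: X]) v >]].
have /choice[r rP] : forall v, exists x, v \in P ->
    pattern l (fset_mulg K E) x = v.
  by move=> v; exact: exists_pattern_preimage.
pose C v := \bigcap_(g in [set` E]) (act g^-1%g @` A (act g (r v))).
apply: (@subcover_cards_image _ _ _ P C).
  by move=> v _; exists (fun g => A (act g (r v))) => // g _; exact: (AP _).1.
move=> x; have xP : pattern l (fset_mulg K E) x \in P by rewrite inE; exists x.
exists (pattern l (fset_mulg K E) x) => // g gE; exists (act g x) => //.
apply: (AP _).2; apply/patternP => k kK; rewrite !eql.
by have /patternP := rP _ xP; move=> /(_ (k * g)%g)-> //; exact: mem_fset_mulg.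
Qed.

(** Every member of the join fixes the label at each site of [E], so points with different patterns
    lie in different members. *)
Lemma dyn_join_subcover_ge (U : set (set X)) (E : {fset G}) (n : nat) :
  (forall A x y, U A -> A x -> A y -> l x 1%g = l y 1%g) ->
  subcover_cards (dyn_join act E U) n -> (pattern_card l E <= n)%N.
Proof.
move=> Ul.
pose P := [pred v | `[< (pattern l E @` [set: X]) v >]].
have /choice[r rP] : forall v, exists x, v \in P -> pattern l E x = v.
  by move=> v; exact: exists_pattern_preimage.
apply: (@subcover_cards_ge _ _ _ P r) => _ v w [V VU <-] vP wP Vv Vw.
rewrite -(rP v vP) -(rP w wP); apply/patternP => g gE.
have [x Vx <-] := Vv g gE; have [y Vy <-] := Vw g gE.
by rewrite !eql mulgV; exact: Ul (VU g gE) Vx Vy.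
Qed.

End DynJoin.

(** * Compactness of subshifts and finite windows for open covers *)

Lemma discrete_set_open (A : finType) (D : set (discrete_topology A)) : open D.
Proof. exact: discrete_open. Qed.

Lemma compact_full_shift (G : groupType) (A : finType) :
  compact [set: full_shift G A].
Proof.
have fin (g : G) : compact [set: discrete_topology A].
  by apply: finite_compact; exact: (@finite_finset A).
have := @tychonoff G (fun=> discrete_topology A) (fun=> setT) fin.
by rewrite (_ : [set f | _] = [set: full_shift G A])// eqEsubset; split.
Qed.

Lemma hausdorff_full_shift (G : groupType) (A : finType) :
  hausdorff_space (full_shift G A).
Proof. by apply: hausdorff_product => g; exact: discrete_hausdorff. Qed.

Lemma full_shift_continuous (T : topologicalType) (G : groupType) (A : finType)
    (f : T -> full_shift G A) :
  (forall g a, open [set x | f x g = a]) -> continuous f.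
Proof.
move=> fo x; apply/cvg_sup.
move=> g; move: x; apply/(@continuousP _ (initial_topology (@^~ g))) => _ [D _ <-].
rewrite (_ : _ @^-1` _ = \bigcup_(a in D) [set x | f x g = a]).
  by apply: bigcup_open => a _; exact: fo.
by rewrite eqEsubset; split => x /=; [move=> Dx; exists (f x g)|move=> [a Da ->]].
Qed.

(** The filter of large finite sets. In [compact_near_coveringP] it turns windows chosen point by
    point into a single one. *)
Definition fset_nbhs (T : choiceType) : set_system {fset T} :=
  [set P | exists K : {fset T}, forall L : {fset T}, (K `<=` L)%fset -> P L].

#[global] Instance fset_nbhs_filter (T : choiceType) : Filter (@fset_nbhs T).
Proof.
split=> [|P Q [K KP] [L LQ]|P Q PQ [K KP]].
- by exists fset0.
- exists (K `|` L)%fset => M; rewrite fsubUset => /andP[KM LM].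
  by split; [exact: KP|exact: LQ].
- by exists K => L /KP /PQ.
Qed.

Lemma fset_nbhsP (T : choiceType) (P : set {fset T}) :
  (\forall K \near @fset_nbhs T, P K) ->
  exists K : {fset T}, forall L : {fset T}, (K `<=` L)%fset -> P L.
Proof. by []. Qed.

Lemma near_pair (T I : Type) (P : set_system T) (Q : set_system I)
    (D : set T) (E : set I) (C : T -> I -> Prop) :
  P D -> Q E -> (forall z i, D z -> E i -> C z i) ->
  \forall z \near P & i \near Q, C z i.
Proof.
move=> PD QE DEC; suff : filter_prod P Q [set zi | C zi.1 zi.2] by [].
by exists (D, E) => // -[z i] [/= Dz Ei]; exact: DEC.
Qed.

Section Points.
Variables (G : groupType) (X : subshift G).

Definition coordinates (x : points X) : G -> alphabet X := val x.

Lemma coordinates_equivariant :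
  equivariant_label (@shift_action G X) coordinates.
Proof. by []. Qed.

Lemma coordinates_inj (x y : points X) : coordinates x = coordinates y -> x = y.
Proof. exact: val_inj. Qed.

Lemma shift_actionK (g : G) (x : points X) :
  shift_action g^-1%g (shift_action g x) = x.
Proof.
apply: coordinates_inj; apply/funext => h.
by rewrite !coordinates_equivariant mulgVK.
Qed.

Lemma points_neq0 : [set: points X] !=set0.
Proof.
by have [x Xx] := carrier_neq0 X; exists (SigSub (mem_set Xx)).
Qed.

Lemma coordinates_open (g : G) (a : alphabet X) :
  open [set x | coordinates x g = a].
Proof.
have cont : continuous (fun x : points X => (val x : full_shift G _) g).
  move=> x; apply: (@continuous_comp _ _ _ (val : points X -> full_shift G _)
    (fun f => f g)).
    exact: initial_continuous.
  exact: (@proj_continuous G (fun=> discrete_topology (alphabet X)) g).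
exact: ((continuousP _).1 cont _ (@discrete_set_open _ [set a])).
Qed.

Lemma pattern_open (K : {fset G}) (x : points X) :
  \forall y \near x, pattern coordinates K y = pattern coordinates K x.
Proof.
have : nbhs x (\bigcap_(g in [set` K])
    [set y | coordinates y g = coordinates x g]).
  apply: filter_bigI => g _; apply: open_nbhs_nbhs; split=> //.
  exact: coordinates_open.
by apply: filterS => y xy; apply/patternP => g; exact: xy.
Qed.

Lemma compact_points : compact [set: points X].
Proof.
move=> P PP _; pose Q : set_system (full_shift G _) := (val : points X -> _) @ P.
have PQ : ProperFilter Q by exact: fmap_proper_filter.
have QX : Q (carrier X).
  apply: (@filterS _ P _ [set: points X]); last exact: filterT.
  by move=> x _; exact: set_valP.
have cX : compact (carrier X).
  apply: (@subclosed_compact _ _ [set: full_shift G _]) => //.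
    exact: carrier_closed.
  exact: compact_full_shift.
have [z [Xz clz]] := cX Q PQ QX.
exists (SigSub (mem_set Xz)); split=> // D N PD.
move=> [_ [[W oW <-] /= Wz WN]].
have QD : Q (val @` D) by apply: (@filterS _ P _ D) => // y Dy; exists y.
have nW : nbhs z W by apply: open_nbhs_nbhs.
have [_ [[y Dy <-] Wy]] := clz _ _ QD nW.
by exists y; split=> //; exact: WN.
Qed.

(** A point y outside [D] differs from [x] at some site g, and so do its neighbours, so windows
    containing g exclude them. By compactness finitely many sites suffice. *)
Lemma open_pattern_nbhs (D : set (points X)) (x : points X) : open D -> D x ->
  exists K : {fset G}, forall y,
    pattern coordinates K y = pattern coordinates K x -> D y.
Proof.
move=> oD Dx.
have /(compact_near_coveringP _).1 cov := compact_points.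
have /(cov _ _ (fun K y => pattern coordinates K y = pattern coordinates K x ->
    D y) (@fset_nbhs_filter G))/fset_nbhsP[K KD] : forall y, [set: points X] y ->
    \forall z \near y & L \near @fset_nbhs G,
      (pattern coordinates L z = pattern coordinates L x -> D z); last first.
  by exists K => y; exact: KD.
move=> y _; have [Dy|nDy] := pselect (D y).
  apply: (@near_pair _ _ (nbhs y) (@fset_nbhs G) D setT) => //.
    exact: open_nbhs_nbhs.
  exact: filterT.
have [g gxy] : exists g, coordinates y g <> coordinates x g.
  apply: contrapT => nex; apply: nDy; rewrite (_ : y = x)//.
  apply: coordinates_inj; apply/funext => g; apply: contrapT => gxy.
  by apply: nex; exists g.
apply: (@near_pair _ _ (nbhs y) (@fset_nbhs G)
    [set z | coordinates z g = coordinates y g]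
    [set K : {fset G} | g \in K]).
- by apply: open_nbhs_nbhs; split => //; exact: coordinates_open.
- by exists [fset g]%fset => L; rewrite fsub1set.
move=> z K /= zy gK /patternP zx; exfalso; apply: gxy.
by rewrite -zy; exact: zx.
Qed.

(** The analogue of a Lebesgue number: a finite window whose patterns refine the cover. *)
Lemma cover_window (U : set (set (points X))) :
  U `<=` open -> \bigcup_(D in U) D = [set: points X] ->
  exists2 K : {fset G}, K != fset0 & forall x, exists2 D, U D &
    forall y, pattern coordinates K y = pattern coordinates K x -> D y.
Proof.
move=> oU covU.
have /(compact_near_coveringP _).1 cov := compact_points.
have /(cov _ _ (fun K x => exists2 D, U D & forall y,
    pattern coordinates K y = pattern coordinates K x -> D y)
    (@fset_nbhs_filter G))/fset_nbhsP[K KU] : forall x, [set: points X] x ->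
    \forall z \near x & L \near @fset_nbhs G, (exists2 D, U D &
      forall y, pattern coordinates L y = pattern coordinates L z -> D y).
  move=> x _.
  have [D UD Dx] : (\bigcup_(D in U) D) x by rewrite covU.
  have [K KD] := open_pattern_nbhs (oU D UD) Dx.
  apply: (@near_pair _ _ (nbhs x) (@fset_nbhs G)
      [set z | pattern coordinates K z = pattern coordinates K x]
      [set L : {fset G} | (K `<=` L)%fset]); [exact: pattern_open|by exists K|].
  move=> z L /= zx /fsubsetP KL; exists D => // y /patternP yz; apply: KD.
  by rewrite -zx; apply/patternP => g /KL; exact: yz.
exists (1%g |` K)%fset; first by apply/fset0Pn; exists 1%g; rewrite fset1U1.
by move=> x; apply: (KU (1%g |` K)%fset) => //; exact: fsubsetU1.
Qed.

End Points.

Lemma fset_mul1g (G : groupType) (E : {fset G}) : fset_mulg [fset 1%g]%fset E = E.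
Proof.
apply/fsetP => g; apply/fset_mulgP/idP => [[k [e [+ eE ->]]]|gE].
  by rewrite inE => /eqP ->; rewrite mul1g.
by exists 1%g, g; rewrite inE eqxx mul1g.
Qed.

Lemma pattern_entropy_comp (R : realType) (G : groupType) (T T' : Type)
    (B : finType) (l : T -> G -> B) (f : T' -> T) : range f = [set: T] ->
  pattern_entropy R (fun x => l (f x)) = pattern_entropy R l.
Proof.
move=> fT; suff e E : pattern_rate R (fun x => l (f x)) E = pattern_rate R l E.
  by rewrite /pattern_entropy; congr (inf _); apply: eq_imagel => E _.
rewrite /pattern_rate; congr (ln _%:R / _); apply: fintype.eq_card => v.
apply/idP/idP; rewrite !inE => -[x _ <-]; first by exists (f x).
have : [set: T] x by []; rewrite -fT => -[y _ <-].
by exists y.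
Qed.

Section SubshiftEntropy.
Variables (R : realType) (G : groupType) (F : nat -> {fset G}).
Hypothesis folnerF : folner_sequence R F.
Variable X : subshift G.

(** The sets on which the label at 1 is constant form an open cover, and the minimal subcovers of
    its joins are counted exactly by patterns. *)
Lemma pattern_entropy_le_subshift (B : finType) (l : points X -> G -> B) :
  equivariant_label (@shift_action G X) l ->
  (forall b, open [set x | l x 1%g = b]) ->
  ((pattern_entropy R l)%:E <= subshift_entropy R F X)%E.
Proof.
move=> eql ol; pose U := range (fun b => [set x | l x 1%g = b]).
have X0 := points_neq0 X; have actK := @shift_actionK G X.
apply: ereal_sup_ubound; exists U => /=.
  split.
  - by apply: finite_image; exact: (@finite_finset B).
  - by move=> _ [b _ <-]; exact: ol.
  - rewrite -subTset => x _; exists [set y | l y 1%g = l x 1%g] => //.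
    by exists (l x 1%g).
congr EFin; rewrite /cover_entropy.
rewrite (_ : (fun n => _) = fun n => pattern_rate R l (F n)); last first.
  apply/funext => n; rewrite /pattern_rate mulrC; congr (ln _%:R / _).
  have [|k Uk kle] :=
    @dyn_join_subcover _ _ _ actK X0 _ l eql U [fset 1%g]%fset (F n).
    move=> x; exists [set y | l y 1%g = l x 1%g]; first by exists (l x 1%g).
    by move=> y /patternP; apply; rewrite inE.
  rewrite fset_mul1g in kle; have [Umin mink] := min_subcoverP Uk.
  apply/eqP; rewrite eqn_leq (leq_trans mink kle)/=.
  apply: (dyn_join_subcover_ge X0 eql) Umin => _ x y [b _ <-] /= -> //.
by apply: cvg_lim => //; exact: (pattern_entropy_cvg folnerF eql).
Qed.

(** The coordinates give one inequality. For the other, a cover with window [K] needs at most as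
    many members over [F n] as there are patterns on K F n. *)
Lemma subshift_entropyE :
  subshift_entropy R F X = (pattern_entropy R (@coordinates G X))%:E.
Proof.
have eqc := @coordinates_equivariant G X.
apply/eqP; rewrite eq_le pattern_entropy_le_subshift ?andbT//; last first.
  by move=> b; exact: coordinates_open.
apply: ge_ereal_sup => _ [U [finU oU covU] <-]; rewrite lee_fin.
have [K K0 KU] := cover_window oU covU.
apply: (lim_le_pattern_entropy folnerF eqc K0) => n.
have F0 : (0 < #|` F n|)%N by rewrite cardfs_gt0; case: folnerF.
have [k Uk kle] :=
  dyn_join_subcover (@shift_actionK G X) (points_neq0 X) eqc (F n) KU.
have [Umin mink] := min_subcoverP Uk.
rewrite mulrC ler_wpM2r//.
have [->|] := eqVneq (min_subcover (dyn_join (@shift_action G X) (F n) U)) 0%N.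
  rewrite ln0// ln_ge0// ler1n; apply: image_card_gt0; exact: points_neq0.
rewrite -lt0n => m0; rewrite ler_ln ?posrE ?ltr0n//.
  by rewrite ler_nat (leq_trans mink).
by apply: image_card_gt0; exact: points_neq0.
Qed.

End SubshiftEntropy.

(** * Subshift factors defined by equivariant labels *)

Section FactorSubshift.
Variables (G : groupType) (X : subshift G) (B : finType).
Variable l : points X -> G -> B.
Hypothesis eql : equivariant_label (@shift_action G X) l.
Hypothesis ol : forall g b, open [set x | l x g = b].

Lemma label_continuous : continuous (l : points X -> full_shift G B).
Proof. exact: full_shift_continuous. Qed.

Lemma label_range_neq0 : range (l : points X -> full_shift G B) !=set0.
Proof. by have [x _] := points_neq0 X; exists (l x); exists x. Qed.

Lemma label_range_closed : closed (range (l : points X -> full_shift G B)).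
Proof.
apply: compact_closed; first exact: hausdorff_full_shift.
apply: continuous_compact; last exact: compact_points.
exact/continuous_subspaceT/label_continuous.
Qed.

Lemma label_range_shift (g : G) (z : full_shift G B) :
  range (l : points X -> full_shift G B) z ->
  range (l : points X -> full_shift G B) (Defs.shift g z).
Proof.
by move=> [x _ <-]; exists (shift_action g x) => //; apply/funext => h; exact: eql.
Qed.

Definition label_subshift : subshift G :=
  Subshift label_range_neq0 label_range_closed label_range_shift.

Definition label_factor (x : points X) : points label_subshift :=
  SigSub (mem_set (imageT (l : points X -> full_shift G B) x)).

Lemma label_factor_range : range label_factor = [set: points label_subshift].
Proof.
rewrite -subTset => z _; have [x _ xz] := set_valP z.
by exists x => //; apply: coordinates_inj.
Qed.

Lemma label_factor_map :
  factor_map (@shift_action G X) (@shift_action G label_subshift) label_factor.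
Proof.
split; last by move=> g x; apply: coordinates_inj; apply/funext => h; exact: eql.
- apply/continuousP => _ [D oD <-].
  exact: (continuousP _).1 label_continuous D oD.
- exact: label_factor_range.
Qed.

End FactorSubshift.

Lemma reveal_open (G : groupType) (X : subshift G) (K : {fset G})
    (P : seq {ffun K -> alphabet X}) (g : G) (b : option {ffun K -> alphabet X}) :
  open [set x | reveal (@coordinates G X) P x g = b].
Proof.
rewrite openE => x /= xb.
have := pattern_open (fset_mulg K [fset g]%fset) x; apply: filterS => y /patternP xy.
rewrite /= -xb /reveal (_ : [ffun k => coordinates y _] =
  [ffun k : K => coordinates x (val k * g)%g])//.
apply/ffunP => k; rewrite !ffunE xy// mem_fset_mulg ?fsvalP//.
by rewrite inE.
Qed.

Theorem theorem1p1 (R : realType) (G : groupType)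
    (countG : countable [set: G]) (infG : infinite_set [set: G])
    (amenG : amenable R G)
    (F : nat -> {fset G}) (folnerF : folner_sequence R F)
    (X : subshift G) :
  dense_in (subshift_factor_entropies R F X)
    [set r : R | (0 <= r%:E <= subshift_entropy R F X)%E].
Proof.
have eqX := @coordinates_equivariant G X.
split=> [r /= [Z [hZ [phi [cphi rphi phiT]]]]|t /=].
  rewrite -hZ; apply/andP; split.
    by rewrite subshift_entropyE// lee_fin pattern_entropy_ge0.
  (* Entropy does not increase under [phi]: the coordinates of [Z] pulled back along [phi] are an
     equivariant label on [X] with open level sets. *)
  rewrite subshift_entropyE// -(pattern_entropy_comp _ _ rphi).
  apply: pattern_entropy_le_subshift => // [g x h|b].
    by rewrite phiT.
  exact: (continuousP _).1 cphi _ (coordinates_open 1%g b).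
rewrite subshift_entropyE// !lee_fin => tX.
move=> D /nbhs_ballP[e /= e0 eD].
(* The tolerance is e / 2 because the approximation is not strict while the ball is open. *)
have [K [P PT]] := exists_reveal_entropy folnerF (points_neq0 X) eqX infG
  (divr_gt0 e0 (ltr0Sn R 1)) tX.
exists (pattern_entropy R (reveal (@coordinates G X) P)); split; last first.
  apply: eD; rewrite /ball/= distrC (le_lt_trans PT)// ltr_pdivrMr//.
  by rewrite mulr_natr mulr2n ltrDl.
pose eqP := reveal_equivariant eqX P.
pose oP := @reveal_open G X K P.
exists (label_subshift eqP oP); split; last first.
  by exists (label_factor eqP oP); exact: label_factor_map.
(* The coordinates of the factor, composed with the surjection from [X], are the revealed label
   itself. *)
rewrite subshift_entropyE//.
by rewrite -(pattern_entropy_comp _ _ (label_factor_range eqP oP)).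
Qed.
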